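(* There is a universal polynomial $p$ in two variables such that the following holds. Let $n\ge 1$, let $\mathcal{X}=\mathcal{X}_1\times\cdots\times\mathcal{X}_n$ be a product of finite state spaces and let $\pi$ be any probability distribution on $\mathcal{X}$. Then for any $0<\varepsilon\le 1$ and any permutation $\sigma$ of $[n]$, $$t^{\mathsf{GD}}_{\mathrm{mix}}(\varepsilon)\le p\left(n,\,t^{\mathsf{SS}(\sigma)}_{\mathrm{mix}}(1/10)\right)\log\left(\frac{1}{\varepsilon\pi_{\min}}\right),$$ where $\pi_{\min}:=\min_{x\in\mathcal{X}:\pi(x)\ne 0}\pi(x)$.
   Context: Notation: $[n]=\{1,\dots,n\}$. For $i\in[n]$, $\mathsf{P}_i$ is the Markov kernel that rerandomizes the $i$-th coordinate according to the conditional distribution of $\pi$ given all other coordinates; it acts on functions by $\mathsf{P}_i f(x)=\mathbb{E}_{X\sim\pi}[f(X)\mid X_{-i}=x_{-i}]$, where $x_{-i}$ is the restriction of $x$ to the coordinates other than $i$. All chains are considered on the support $\{x:\pi(x)\neq 0\}$ of $\pi$. Glauber dynamics has transition matrix $\mathsf{P}_{\mathsf{GD}}=\frac1n\sum_{i=1}^n\mathsf{P}_i$. The systematic scan with order $\sigma$ has transition matrix $\mathsf{P}_\sigma=\mathsf{P}_{\sigma(n)}\cdots\mathsf{P}_{\sigma(1)}$; one step of this chain is a full round of $n$ site updates. Total variation distance: $d_{\mathsf{TV}}(\mu,\nu)=\frac12\sum_x|\mu(x)-\nu(x)|$. For a transition matrix $\mathsf{P}$ with stationary distribution $\pi$, the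 mixing time is $t^{\mathsf{P}}_{\mathrm{mix}}(\varepsilon)=\min\{t\ge 0:\max_x d_{\mathsf{TV}}(\mathsf{P}^t(x,\cdot),\pi)\le\varepsilon\}$, the maximum being over the support of $\pi$, with value $\infty$ if no such $t$ exists (if $t^{\mathsf{SS}(\sigma)}_{\mathrm{mix}}(1/10)=\infty$ the claimed inequality is regarded as trivially true). $t^{\mathsf{GD}}_{\mathrm{mix}}$ and $t^{\mathsf{SS}(\sigma)}_{\mathrm{mix}}$ denote the mixing times of $\mathsf{P}_{\mathsf{GD}}$ and $\mathsf{P}_\sigma$. *)

(* Defs.v *)
From HB Require Import structures.
From mathcomp Require Import all_boot all_order all_algebra all_fingroup.
From mathcomp Require Import boolp reals constructive_ereal exp.

Set Implicit Arguments.
Unset Strict Implicit.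
Unset Printing Implicit Defensive.

Import Order.TTheory GRing.Theory Num.Theory.

Local Open Scope ring_scope.

Section MixingTime.
Context {R : realType} {N : nat}.

Definition dTV (mu nu : 'rV[R]_N) : R :=
  2%:R^-1 * \sum_x `|mu 0 x - nu 0 x|.

(* The distances are nonnegative, so 0 is a neutral default for the maximum. *)
Definition max_dTV (P : 'M[R]_N) (pi : 'rV[R]_N) (t : nat) : R :=
  \big[Num.max/0]_x dTV (row x (P ^+ t)) pi.

Definition mixing_time (P : 'M[R]_N) (pi : 'rV[R]_N) (eps : R) : \bar R :=
  match pselect (exists t, max_dTV P pi t <= eps) with
  | left mixes => (ex_minn mixes)%:R%:E
  | right _ => +oo%E
  end.

End MixingTime.

Section SiteUpdates.
Context {R : realType} {n : nat} {X : 'I_n -> finType}.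

Local Notation state := {dffun forall i : 'I_n, X i}.

Implicit Type pi : state -> R.

Definition agree_off (i : 'I_n) (x y : state) : bool :=
  [forall j, (j != i) ==> (x j == y j)].

Definition supp pi : {set state} := [set x | pi x != 0].

(* The minimum is taken over values in [0, 1], so the default 1 is neutral. *)
Definition pi_min pi : R := \big[Num.min/1]_(x in supp pi) pi x.

(* Chains on the support are matrices whose row and column indices enumerate  *)
(* it through enum_val.                                                       *)
Definition stationary pi : 'rV[R]_#|supp pi| := \row_x pi (enum_val x).

(* The (x, y) entry is Pr[X = y | X_{-i} = x_{-i}] for X ~ pi, so that        *)
(* sum_y P_i(x, y) f(y) = E[f(X) | X_{-i} = x_{-i}]. The conditioning event   *)
(* contains x, hence has positive probability.                                *)
Definition site_update pi (i : 'I_n) : 'M[R]_#|supp pi| :=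
  \matrix_(x, y)
    if agree_off i (enum_val x) (enum_val y)
    then pi (enum_val y) / \sum_(z | agree_off i (enum_val x) z) pi z
    else 0.

Definition glauber pi : 'M[R]_#|supp pi| :=
  n%:R^-1 *: \sum_(i < n) site_update pi i.

(* rev_ord makes this P_{s(n)} ... P_{s(1)}, with s(n) leftmost. *)
Definition systematic_scan pi (s : 'S_n) : 'M[R]_#|supp pi| :=
  \prod_(i < n) site_update pi (s (rev_ord i)).

End SiteUpdates.

(* Main.v *)
Require Import Defs.
From HB Require Import structures.
From mathcomp Require Import all_boot all_order all_algebra all_fingroup.
From mathcomp Require Import boolp reals constructive_ereal exp.
From mathcomp Require Import ring lra.

Set Implicit Arguments.
Unset Strict Implicit.
Unset Printing Implicit Defensive.

Import Order.TTheory GRing.Theory Num.Theory.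

Local Open Scope ring_scope.

(** Write K for the systematic scan P_{s(n)} ... P_{s(1)}, G for the Glauber
    kernel, and, for a kernel A preserving the law w, put
      jump A f = E (f(X_0) - f(X_1))^2,  X_0 ~ w,  X_1 ~ A(X_0, .).
    The spectral gap of G is bounded below by following a function along the
    scan.

    If K^t is within 1/10 of w in total variation from every start, any two
    rows of K^t overlap in mass at least 4/5.  Two independent points X, X'
    drawn from w can therefore be joined through a common point reached from
    both, so the variance of f is at most a constant times jump K^t f
    ([variance_le_jump]).  On the other hand one run of K^t is n t single-site
    moves, each started from equilibrium because every P_i preserves w, so the
    Cauchy-Schwarz inequality gives jump K^t f <= n t^2 sum_i jump P_i f
    ([jump_prod], [jump_exp]).  The right-hand side forgets the order of the
    updates: since jump P_i f = 2 (<f, f> - <f, P_i f>), its sum is 2 n times the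
    Dirichlet form <f, f> - <f, G f>.  This is a Poincare inequality for G with
    constant 5 n^2 t^2 ([average_poincare]).

    Each P_i is an orthogonal projection in L^2(w), so G is positive
    semidefinite, and |G f|^2 <= <f, G f> ([average_sqr_le]).  With the Poincare
    inequality this makes G contract mean-zero functions by 1 - 1/C in squared
    norm, where C = 5 n^2 (t + 1)^2 ([average_contraction]); applied to the
    density of a point mass relative to w it bounds total variation after k
    steps by (1 - 1/C)^(k/2) pi_min^(-1/2) / 2 ([dTV_exp_le]).  Taking k near
    2 C ln (1 / (eps pi_min)) brings the distance below eps ([decay_bound]), and
    p(n, t) = 10 n^2 (t + 1)^2. *)

(** * Mixing times *)

Section MixingTimeBounds.
Context {R : realType} {N : nat}.
Implicit Types (P : 'M[R]_N) (pi : 'rV[R]_N) (eps : R).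

Lemma mixing_time_le P pi eps k :
  max_dTV P pi k <= eps -> (mixing_time P pi eps <= k%:R%:E)%E.
Proof.
rewrite /mixing_time => Pk; case: pselect => [mixes|[]]; last by exists k.
by case: ex_minnP => m _ /(_ k Pk) le_mk; rewrite lee_fin ler_nat.
Qed.

Lemma mixing_time_attained P pi eps t :
  mixing_time P pi eps = t%:R%:E -> max_dTV P pi t <= eps.
Proof.
rewrite /mixing_time; case: pselect => // mixes.
by case: ex_minnP => m Pm _ [] /eqP; rewrite eqr_nat => /eqP <-.
Qed.

Lemma dTV_le_max P pi t x : dTV (row x (P ^+ t)) pi <= max_dTV P pi t.
Proof. exact: (le_bigmax 0 (fun x => dTV (row x (P ^+ t)) pi)). Qed.

End MixingTimeBounds.

(** * Kernels, inner product and mean square jump *)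

Section Kernels.
Context {R : realType} {N : nat} (w : 'rV[R]_N).
Implicit Types (A B : 'M[R]_N) (f g : 'cV[R]_N).

Definition stochastic A :=
  (forall x y, 0 <= A x y) /\ (forall x, \sum_y A x y = 1).

Definition reversible A := forall x y, w 0 x * A x y = w 0 y * A y x.

Definition dot f g : R := \sum_x w 0 x * f x 0 * g x 0.

Definition jump A f : R :=
  \sum_x \sum_y w 0 x * A x y * (f x 0 - f y 0) ^+ 2.

Lemma stochastic1 : stochastic (1 : 'M[R]_N).
Proof.
split=> [x y|x]; first by rewrite !mxE ler0n.
rewrite (bigD1 x) //= mxE eqxx big1 ?addr0 // => y ne_yx.
by rewrite mxE eq_sym (negbTE ne_yx).
Qed.

Lemma stochasticM A B : stochastic A -> stochastic B -> stochastic (A * B).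
Proof.
move=> [A0 A1] [B0 B1]; split=> [x z|x].
  by rewrite -mulmxE mxE sumr_ge0 // => y _; rewrite mulr_ge0.
rewrite -(A1 x) -mulmxE.
under eq_bigr do rewrite mxE.
rewrite exchange_big /=; apply: eq_bigr => y _.
by rewrite -mulr_sumr B1 mulr1.
Qed.

Lemma stochasticX A k : stochastic A -> stochastic (A ^+ k).
Proof.
move=> sA; elim: k => [|k IHk]; first by rewrite expr0; exact: stochastic1.
by rewrite exprS; exact: stochasticM.
Qed.

Lemma stochastic_prod m (F : 'I_m -> 'M[R]_N) :
  (forall i, stochastic (F i)) -> stochastic (\prod_i F i).
Proof.
move=> sF; elim/big_ind: _ => //; [exact: stochastic1 | exact: stochasticM].
Qed.

Lemma invariantX A k : w *m A = w -> w *m A ^+ k = w.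
Proof.
move=> wA; elim: k => [|k IHk]; first by rewrite expr0 -idmxE mulmx1.
by rewrite exprS -mulmxE mulmxA wA.
Qed.

Lemma invariant_prod m (F : 'I_m -> 'M[R]_N) :
  (forall i, w *m F i = w) -> w *m \prod_i F i = w.
Proof.
move=> wF; elim/big_ind: _ => //; first by rewrite -idmxE mulmx1.
by move=> A B wA wB; rewrite -mulmxE mulmxA wA.
Qed.

Lemma reversible_invariant A : stochastic A -> reversible A -> w *m A = w.
Proof.
move=> [_ A1] rA; apply/rowP => y; rewrite mxE.
under eq_bigr do rewrite rA.
by rewrite -mulr_sumr A1 mulr1.
Qed.

Lemma reversibleX A k : reversible A -> reversible (A ^+ k).
Proof.
move=> rA; elim: k => [|k IHk] x z.
  by rewrite !mxE eq_sym; case: eqP => [->|]; rewrite ?mulr0.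
rewrite {1}exprS exprSr -!mulmxE !mxE !mulr_sumr; apply: eq_bigr => y _.
by rewrite mulrA rA mulrAC IHk; ring.
Qed.

Lemma dot_mul A f g : reversible A -> dot (A *m f) g = dot f (A *m g).
Proof.
move=> rA; rewrite /dot.
under eq_bigr do rewrite mxE mulr_sumr mulr_suml.
under [RHS]eq_bigr do rewrite mxE mulr_sumr.
rewrite exchange_big; apply: eq_bigr => x _; apply: eq_bigr => y _.
by rewrite mulrA rA; ring.
Qed.

Lemma dot_sumr m f (F : 'I_m -> 'cV[R]_N) :
  dot f (\sum_i F i) = \sum_i dot f (F i).
Proof.
rewrite /dot exchange_big /=; apply: eq_bigr => x _.
by rewrite summxE mulr_sumr.
Qed.

Lemma dotZr a f g : dot f (a *: g) = a * dot f g.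
Proof. by rewrite /dot mulr_sumr; apply: eq_bigr => x _; rewrite mxE; ring. Qed.

Context (w_ge0 : forall x, 0 <= w 0 x).

Lemma dot_AMGM f g : 2 * dot f g <= dot f f + dot g g.
Proof.
rewrite /dot mulr_sumr -big_split /=; apply: ler_sum => x _.
rewrite -subr_ge0 (_ : _ - _ = w 0 x * (f x 0 - g x 0) ^+ 2); last by ring.
by rewrite mulr_ge0 ?sqr_ge0.
Qed.

(** The mean square jump is twice the Dirichlet form; invariance of w makes the
    two square terms equal. *)
Lemma jump_dot A f : stochastic A -> w *m A = w ->
  jump A f = 2 * (dot f f - dot f (A *m f)).
Proof.
move=> [_ A1] wA.
have fx : \sum_x \sum_y w 0 x * A x y * (f x 0 * f x 0) = dot f f.
  apply: eq_bigr => x _; rewrite -mulr_suml -mulr_sumr A1; ring.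
have fy : \sum_x \sum_y w 0 x * A x y * (f y 0 * f y 0) = dot f f.
  rewrite exchange_big; apply: eq_bigr => y _.
  by rewrite -mulr_suml -[in RHS]wA mxE mulrA.
have fxy : \sum_x \sum_y w 0 x * A x y * (f x 0 * f y 0) = dot f (A *m f).
  apply: eq_bigr => x _; rewrite mxE mulr_sumr.
  by apply: eq_bigr => y _; ring.
transitivity (dot f f + dot f f - 2 * dot f (A *m f)); last by ring.
rewrite -{1}fx -fy -fxy mulr_sumr -sumrN -!big_split; apply: eq_bigr => x _ /=.
rewrite mulr_sumr -sumrN -!big_split; apply: eq_bigr => y _ /=.
by ring.
Qed.

Lemma jump1 f : jump 1 f = 0.
Proof.
rewrite /jump big1 // => x _; rewrite big1 // => y _; rewrite mxE.
by case: eqP => [->|_]; rewrite ?subrr ?expr0n ?mulr0 ?mul0r.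
Qed.

(** A jump of A * B is a jump of A followed by a jump of B, which again starts
    from w.  Young's inequality with a free weight c replaces the triangle
    inequality for square roots of jumps. *)
Lemma jump_mul A B f (c : R) : stochastic A -> stochastic B -> w *m A = w ->
  0 < c -> jump (A * B) f <= (1 + c^-1) * jump A f + (1 + c) * jump B f.
Proof.
move=> [A0 A1] [B0 B1] wA c0.
have jA : jump A f =
    \sum_x \sum_y \sum_z w 0 x * A x y * B y z * (f x 0 - f y 0) ^+ 2.
  apply: eq_bigr => x _; apply: eq_bigr => y _.
  by rewrite -mulr_suml -mulr_sumr B1 mulr1.
have jB : jump B f =
    \sum_x \sum_y \sum_z w 0 x * A x y * B y z * (f y 0 - f z 0) ^+ 2.
  rewrite exchange_big; apply: eq_bigr => y _.
  rewrite exchange_big; apply: eq_bigr => z _.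
  by rewrite -!mulr_suml -[in LHS]wA mxE.
rewrite jA jB !mulr_sumr -big_split; apply: ler_sum => x _ /=.
rewrite !mulr_sumr.
under eq_bigr do rewrite -mulmxE mxE mulr_sumr mulr_suml.
rewrite exchange_big -big_split; apply: ler_sum => y _ /=.
rewrite !mulr_sumr -big_split; apply: ler_sum => z _ /=.
have cV0 : 0 < c^-1 by rewrite invr_gt0.
move: (f x 0) (f y 0) (f z 0) => a b d.
rewrite -subr_ge0.
rewrite (_ : _ - _ = w 0 x * A x y * B y z *
   ((1 + c^-1) * (a - b) ^+ 2 + (1 + c) * (b - d) ^+ 2 - (a - d) ^+ 2));
  last by ring.
rewrite !mulr_ge0 //.
(* The excess is a perfect square: this is Young's inequality. *)
rewrite (_ : _ - _ = c^-1 * ((a - b) - c * (b - d)) ^+ 2); last first.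
  by field; rewrite gt_eqF.
by rewrite mulr_ge0 ?sqr_ge0 // ltW.
Qed.

(** The Cauchy-Schwarz bound along m successive moves; the induction step uses
    [jump_mul] with weight c = m, which is where both terms reach the
    factor m + 1. *)
Lemma jump_prod m (F : 'I_m -> 'M[R]_N) f :
  (forall i, stochastic (F i)) -> (forall i, w *m F i = w) ->
  jump (\prod_i F i) f <= m%:R * \sum_i jump (F i) f.
Proof.
elim: m F => [|m IHm] F sF wF; first by rewrite !big_ord0 jump1 mulr0.
rewrite !big_ord_recr /=.
set A := \prod_i _; set B := F ord_max; set S := \sum_i _.
have [m0|m_gt0] := posnP m.
  rewrite /A /S; case: _ / (esym m0) F sF wF {IHm} @A @B @S => F *.
  by rewrite !big_ord0 mul1r add0r mul1r.
have m0 : 0 < m%:R :> R by rewrite ltr0n.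
have sA : stochastic A by exact: stochastic_prod.
have wA : w *m A = w by exact: invariant_prod.
apply: (le_trans (jump_mul f sA (sF _) wA m0)).
have /(ler_wpM2l (_ : 0 <= 1 + m%:R^-1)) : jump A f <= m%:R * S by exact: IHm.
rewrite addr_ge0 ?invr_ge0 ?ler0n // => /(_ isT) le_A.
rewrite mulrDr -natr1 [m%:R + 1]addrC lerD2r (le_trans le_A) // mulrA.
by rewrite mulrDl mul1r mulVf ?gt_eqF // addrC.
Qed.

Lemma jump_exp A t f : stochastic A -> w *m A = w ->
  jump (A ^+ t) f <= t%:R ^+ 2 * jump A f.
Proof.
move=> sA wA; have := jump_prod f (fun _ : 'I_t => sA) (fun _ => wA).
rewrite prodr_const sumr_const card_ord -[jump A f *+ t]mulr_natl.
by rewrite mulrA -expr2.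
Qed.

(** * Spectral gap of the averaged kernel *)

(** Up to a factor 2 on both sides: min(a, b) is at most a and at most b, so it
    weighs (u - v)^2 <= 2 (u^2 + v^2) by at most 2 (a u^2 + b v^2).  Writing
    twice the minimum as a + b - |a - b| lets its sum be read off from total
    variation. *)
Lemma meet_sqr_le (a b u v : R) : 0 <= a -> 0 <= b ->
  (a + b - `|a - b|) * (u - v) ^+ 2 <= 4 * (a * u ^+ 2 + b * v ^+ 2).
Proof.
move=> a0 b0.
have uv : (u - v) ^+ 2 <= 2 * (u ^+ 2 + v ^+ 2).
  by rewrite -subr_ge0 (_ : _ - _ = (u + v) ^+ 2) ?sqr_ge0 //; ring.
have [u0 v0] : 0 <= u ^+ 2 /\ 0 <= v ^+ 2 by rewrite !sqr_ge0.
case: (lerP a b) => ab.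
  have -> : a + b - (b - a) = 2 * a by ring.
  by nra.
have -> : a + b - (a - b) = 2 * b by ring.
by nra.
Qed.

Context (w_sum1 : \sum_x w 0 x = 1).

(** The coupling argument: since the rows of x and y overlap, f(x) - f(y) splits
    through a point z weighted by min(A x z, A y z), and each half is a jump of
    A.  Reversibility of A would be unavailable here: a systematic scan has a
    direction. *)
Lemma variance_le_jump A f : stochastic A ->
  (forall x, dTV (row x A) w <= 1 / 10%:R) ->
  \sum_x \sum_y w 0 x * w 0 y * (f x 0 - f y 0) ^+ 2 <= 5%:R * jump A f.
Proof.
move=> [A0 A1] Aw.
have overlap x y : 8%:R / 5%:R <= \sum_z (A x z + A y z - `|A x z - A y z|).
  rewrite big_split sumrN /= big_split /= !A1.
  (* dTV is half of the L1 distance, so the triangle inequality costs 2/5. *)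
  have d v : \sum_z `|A v z - w 0 z| <= 1 / 5%:R.
    have := Aw v; rewrite /dTV.
    under eq_bigr do rewrite mxE.
    by lra.
  have : \sum_z `|A x z - A y z| <=
         \sum_z `|A x z - w 0 z| + \sum_z `|A y z - w 0 z|.
    rewrite -big_split; apply: ler_sum => z _ /=.
    by rewrite [`|A y z - _|]distrC ler_distD.
  by have := d x; have := d y; lra.
have pair x y : 8%:R / 5%:R * (f x 0 - f y 0) ^+ 2 <=
    4%:R * (\sum_z A x z * (f x 0 - f z 0) ^+ 2 +
            \sum_z A y z * (f y 0 - f z 0) ^+ 2).
  apply: le_trans (ler_wpM2r (sqr_ge0 _) (overlap x y)) _.
  rewrite -big_split /= mulr_suml mulr_sumr; apply: ler_sum => z _ /=.
  have := meet_sqr_le (f x 0 - f z 0) (f y 0 - f z 0) (A0 x z) (A0 y z).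
  by rewrite (_ : _ - _ - _ = f x 0 - f y 0) //; ring.
have jE : jump A f = \sum_x w 0 x * \sum_z A x z * (f x 0 - f z 0) ^+ 2.
  apply: eq_bigr => x _; rewrite mulr_sumr.
  by apply: eq_bigr => z _; rewrite mulrA.
set h := fun x => \sum_z A x z * (f x 0 - f z 0) ^+ 2 in pair jE.
have sum_l : \sum_x \sum_y w 0 x * w 0 y * h x = jump A f.
  rewrite jE; apply: eq_bigr => x _.
  by rewrite -mulr_suml -mulr_sumr w_sum1 mulr1.
have sum_r : \sum_x \sum_y w 0 x * w 0 y * h y = jump A f.
  rewrite exchange_big jE; apply: eq_bigr => x _.
  by rewrite -!mulr_suml w_sum1 mul1r.
suff : 8%:R / 5%:R * \sum_x \sum_y w 0 x * w 0 y * (f x 0 - f y 0) ^+ 2 <=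
    4%:R * (jump A f + jump A f) by lra.
rewrite -{1}sum_l -sum_r -big_split /= !mulr_sumr; apply: ler_sum => x _.
rewrite -big_split !mulr_sumr; apply: ler_sum => y _ /=.
have ww : 0 <= w 0 x * w 0 y by rewrite mulr_ge0.
have := ler_wpM2l ww (pair x y).
rewrite -mulrDr [leLHS]mulrCA [leRHS]mulrCA; exact.
Qed.

Definition mean f : R := \sum_x w 0 x * f x 0.

(** Independent sampling from w is itself a kernel, and it kills mean-zero f. *)
Lemma variance_dot f : mean f = 0 ->
  \sum_x \sum_y w 0 x * w 0 y * (f x 0 - f y 0) ^+ 2 = 2 * dot f f.
Proof.
move=> f0.
have /= := @jump_dot (\matrix_(x, y) w 0 y) f.
rewrite (_ : dot f (_ *m _) = 0); last first.
  rewrite /dot big1 // => x _; rewrite mxE.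
  under eq_bigr do rewrite mxE.
  by rewrite -/(mean f) f0 mulr0.
rewrite subr0 => <-.
- by apply: eq_bigr => x _; apply: eq_bigr => y _; rewrite mxE.
- by split=> [x y|x]; [rewrite mxE | under eq_bigr do rewrite mxE].
- apply/rowP => y; rewrite mxE.
  by under eq_bigr do rewrite mxE; rewrite -mulr_suml w_sum1 mul1r.
Qed.

Lemma mean_mul A f : w *m A = w -> mean (A *m f) = mean f.
Proof.
have E g : mean g = (w *m g) 0 0 by rewrite mxE.
by move=> wA; rewrite !E mulmxA wA.
Qed.

(** Nonnegativity of the variance of |f|. *)
Lemma L1_le_dot f : (\sum_x w 0 x * `|f x 0|) ^+ 2 <= dot f f.
Proof.
have [m mE] : exists m, m = \sum_x w 0 x * `|f x 0| by eexists.
have : 0 <= \sum_x w 0 x * (`|f x 0| - m) ^+ 2.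
  by apply: sumr_ge0 => x _; rewrite mulr_ge0 ?sqr_ge0.
rewrite (_ : \sum_x _ =
  dot f f - 2 * m * (\sum_x w 0 x * `|f x 0|) + m ^+ 2 * \sum_x w 0 x).
  by rewrite -mE w_sum1; lra.
rewrite /dot !mulr_sumr -sumrN -!big_split; apply: eq_bigr => x _ /=.
rewrite sqrrB -normrX ger0_norm ?sqr_ge0 //; ring.
Qed.

Lemma dot_average m (F : 'I_m -> 'M[R]_N) P f g :
  (0 < m)%N -> P = m%:R^-1 *: \sum_i F i ->
  m%:R * dot g (P *m f) = \sum_i dot g (F i *m f).
Proof.
move=> m_gt0 ->; rewrite -dot_sumr -mulmx_suml -dotZr -scalemxAl scalerA.
by rewrite divff ?scale1r // pnatr_eq0 -lt0n.
Qed.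

(** The average P of orthogonal projections is positive semidefinite: the
    projection F i has <f, F_i f> = |F_i f|^2, so averaging
    2 <P f, F_i f> <= |P f|^2 + |F_i f|^2 gives
    2 |P f|^2 <= |P f|^2 + <f, P f>. *)
Lemma average_sqr_le m (F : 'I_m -> 'M[R]_N) P f :
  (0 < m)%N -> P = m%:R^-1 *: \sum_i F i ->
  (forall i, reversible (F i)) -> (forall i, F i *m F i = F i) ->
  dot (P *m f) (P *m f) <= dot f (P *m f).
Proof.
move=> m_gt0 defP rF idF.
have proj i : dot (F i *m f) (F i *m f) = dot f (F i *m f).
  by rewrite dot_mul // mulmxA idF.
have : \sum_i 2 * dot (P *m f) (F i *m f) <=
       \sum_i (dot (P *m f) (P *m f) + dot f (F i *m f)).
  by apply: ler_sum => i _; rewrite -proj dot_AMGM.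
rewrite -mulr_sumr big_split sumr_const card_ord /=.
rewrite -!(dot_average _ _ m_gt0 defP).
by rewrite -[dot _ _ *+ m]mulr_natl -mulrDr mulrCA ler_pM2l ?ltr0n //; lra.
Qed.

Lemma dot_iter_le P (c : R) f k : 0 <= c -> w *m P = w -> mean f = 0 ->
  (forall g, mean g = 0 -> dot (P *m g) (P *m g) <= c * dot g g) ->
  dot (P ^+ k *m f) (P ^+ k *m f) <= c ^+ k * dot f f.
Proof.
move=> c0 wP f0 contr; elim: k => [|k IHk].
  by rewrite !expr0 mul1r -idmxE mul1mx.
rewrite exprS -mulmxE -mulmxA (le_trans (contr _ _)) //.
  by rewrite mean_mul // invariantX.
by rewrite exprS -mulrA ler_wpM2l.
Qed.

(** A mixing product of the kernels, in whatever order, forces a spectral gap on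
    their average: the sum of the jumps of the factors does not see the order
    and is, up to scaling, the Dirichlet form of P. *)
Lemma average_poincare m (F : 'I_m -> 'M[R]_N) P (h : 'I_m -> 'I_m) t f :
  (0 < m)%N -> P = m%:R^-1 *: \sum_i F i ->
  (forall i, stochastic (F i)) -> (forall i, reversible (F i)) ->
  injective h ->
  (forall x, dTV (row x ((\prod_i F (h i)) ^+ t)) w <= 1 / 10%:R) ->
  mean f = 0 ->
  dot f f <= 5%:R * t%:R ^+ 2 * m%:R ^+ 2 * (dot f f - dot f (P *m f)).
Proof.
move=> m_gt0 defP sF rF inj_h mix f0.
have m0 : m%:R != 0 :> R by rewrite pnatr_eq0 -lt0n.
have wF i : w *m F i = w by exact: reversible_invariant.
set K := \prod_i F (h i) in mix.
have sK : stochastic K by exact: stochastic_prod.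
have wK : w *m K = w by exact: invariant_prod.
have sumF : \sum_i jump (F (h i)) f = 2 * m%:R * (dot f f - dot f (P *m f)).
  rewrite -(reindex_inj inj_h (P := predT) (F := fun i => jump (F i) f)) /=.
  under eq_bigr do rewrite jump_dot //.
  rewrite -mulr_sumr sumrB sumr_const card_ord -(dot_average _ _ m_gt0 defP).
  by rewrite -[dot f f *+ m]mulr_natl; ring.
have jK : jump K f <= m%:R * \sum_i jump (F (h i)) f by exact: jump_prod.
have jKt := jump_exp t f sK wK.
have := variance_le_jump f (stochasticX t sK) mix.
have t0 : 0 <= t%:R ^+ 2 :> R by exact: sqr_ge0.
have := ler_wpM2l t0 jK; rewrite sumF variance_dot //.
by lra.
Qed.

(** Using t + 1 in place of t keeps the constant invertible when t = 0. *)
Lemma average_contraction m (F : 'I_m -> 'M[R]_N) P (h : 'I_m -> 'I_m) t f :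
  (0 < m)%N -> P = m%:R^-1 *: \sum_i F i ->
  (forall i, stochastic (F i)) -> (forall i, reversible (F i)) ->
  (forall i, F i *m F i = F i) -> injective h ->
  (forall x, dTV (row x ((\prod_i F (h i)) ^+ t)) w <= 1 / 10%:R) ->
  mean f = 0 ->
  dot (P *m f) (P *m f) <=
    (1 - (5%:R * m%:R ^+ 2 * (t%:R + 1) ^+ 2)^-1) * dot f f.
Proof.
move=> m_gt0 defP sF rF idF inj_h mix f0.
have gap := average_poincare m_gt0 defP sF rF inj_h mix f0.
have psd := average_sqr_le f m_gt0 defP rF idF.
have amgm := dot_AMGM f (P *m f).
apply: (le_trans psd); move: amgm gap psd.
move: (dot f f) (dot f (P *m f)) (dot (P *m f) (P *m f)) => a b c amgm gap psd.
have m1 : 0 < m%:R ^+ 2 :> R by rewrite exprn_gt0 ?ltr0n.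
have t2 : 0 < (t%:R + 1) ^+ 2 :> R by rewrite exprn_gt0 // ltr_wpDl ?ler0n.
have t0 : 0 <= t%:R :> R by rewrite ler0n.
have t1 : t%:R ^+ 2 <= (t%:R + 1) ^+ 2 :> R by rewrite ler_sqr ?nnegrE; lra.
set C := 5%:R * _ * _.
have C0 : 0 < C by rewrite mulr_gt0 // mulr_gt0 // ltr0n.
have gapC : a <= C * (a - b).
  apply: le_trans gap _; apply: ler_wpM2r; first by lra.
  by have := ler_wpM2l (ltW m1) t1; rewrite /C; lra.
have : C^-1 * a <= a - b by rewrite ler_pdivrMl.
by lra.
Qed.

(** * From contraction in L2 to total variation *)

Context (w_gt0 : forall x, 0 < w 0 x).

Lemma stochastic_average m (F : 'I_m -> 'M[R]_N) P :
  (0 < m)%N -> P = m%:R^-1 *: \sum_i F i ->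
  (forall i, stochastic (F i)) -> stochastic P.
Proof.
move=> m_gt0 -> sF; split=> [x y|x].
  rewrite mxE summxE mulr_ge0 ?invr_ge0 // sumr_ge0 // => i _.
  by have [] := sF i.
under eq_bigr do rewrite mxE summxE.
rewrite -mulr_sumr exchange_big /=.
under eq_bigr => i _ do rewrite (proj2 (sF i)).
by rewrite sumr_const card_ord mulVf // pnatr_eq0 -lt0n.
Qed.

Lemma reversible_average m (F : 'I_m -> 'M[R]_N) P :
  P = m%:R^-1 *: \sum_i F i -> (forall i, reversible (F i)) -> reversible P.
Proof.
move=> -> rF x y; rewrite !mxE !summxE mulrCA [RHS]mulrCA !mulr_sumr.
by apply: eq_bigr => i _; rewrite rF.
Qed.

(** The density of the point mass at x relative to w, centred to mean zero. *)
Definition density x : 'cV[R]_N := \col_y ((y == x)%:R / w 0 x - 1).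

Lemma sum_delta (F : 'I_N -> R) x : \sum_y F y * (y == x)%:R = F x.
Proof.
rewrite (bigD1 x) //= eqxx mulr1 big1 ?addr0 // => y /negbTE ->.
by rewrite mulr0.
Qed.

Lemma mean_density x : mean (density x) = 0.
Proof.
transitivity (\sum_y w 0 y / w 0 x * (y == x)%:R - \sum_y w 0 y).
  by rewrite -sumrB; apply: eq_bigr => y _; rewrite mxE; ring.
by rewrite sum_delta w_sum1 mulfV ?subrr // gt_eqF.
Qed.

Lemma dot_density x : dot (density x) (density x) <= (w 0 x)^-1.
Proof.
have -> : dot (density x) (density x) =
    \sum_y w 0 y * ((w 0 x)^-1 ^+ 2 - 2 * (w 0 x)^-1) * (y == x)%:R +
    \sum_y w 0 y.
  rewrite /dot -big_split; apply: eq_bigr => y _ /=; rewrite !mxE.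
  by case: (y == x) => /=; ring.
have w0 : w 0 x != 0 by rewrite gt_eqF.
rewrite sum_delta w_sum1 (_ : _ + _ = (w 0 x)^-1 - 1); first by lra.
by field.
Qed.

(** A acts on functions, so this is column x of A; for a reversible A it is also
    the centred density of the law of the chain started at x. *)
Lemma mul_density A x y : stochastic A ->
  (A *m density x) y 0 = A y x / w 0 x - 1.
Proof.
move=> [_ A1]; rewrite mxE.
transitivity (\sum_z A y z / w 0 x * (z == x)%:R - \sum_z A y z).
  by rewrite -sumrB; apply: eq_bigr => z _; rewrite mxE; ring.
by rewrite A1 sum_delta.
Qed.

(** Total variation is an L1 norm of densities, which the L2 norm dominates. *)
Lemma dTV_le_dot A x : stochastic A -> reversible A ->
  (2 * dTV (row x A) w) ^+ 2 <= dot (A *m density x) (A *m density x).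
Proof.
move=> sA rA; apply: le_trans (L1_le_dot _).
rewrite le_eqVlt; apply/orP; left; apply/eqP; congr (_ ^+ 2).
rewrite /dTV mulrA divff ?mul1r ?pnatr_eq0 //; apply: eq_bigr => y _.
rewrite mul_density // mxE -{2}(ger0_norm (w_ge0 y)) -normrM mulrBr mulr1 mulrA.
by rewrite -rA mulrAC divff ?mul1r // gt_eqF.
Qed.

Lemma dTV_exp_le P (c : R) k x : 0 <= c -> stochastic P -> reversible P ->
  (forall g, mean g = 0 -> dot (P *m g) (P *m g) <= c * dot g g) ->
  (2 * dTV (row x (P ^+ k)) w) ^+ 2 <= c ^+ k * (w 0 x)^-1.
Proof.
move=> c0 sP rP contr.
apply: le_trans (dTV_le_dot x (stochasticX k sP) (reversibleX k rP)) _.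
have wP := reversible_invariant sP rP.
apply: le_trans (dot_iter_le k c0 wP (mean_density x) contr) _.
by rewrite ler_wpM2l ?exprn_ge0 ?dot_density.
Qed.

End Kernels.

(** * Choice of the number of steps *)

(** The number of steps k is 2 C ln (1 / (eps m)) rounded down: rounding up would
    break the bound when the logarithm is close to 0.  The price is at most one
    factor 1 - 1/C >= 1/2, absorbed by the 4 in (2 eps)^2. *)
Lemma decay_bound (R : realType) (C eps m : R) : 2 <= C -> 0 < eps <= 1 ->
  0 < m <= 1 -> exists2 k : nat, k%:R <= 2 * C * ln (1 / (eps * m)) &
  (1 - C^-1) ^+ k * m^-1 <= (2 * eps) ^+ 2.
Proof.
move=> C2 /andP[e0 e1] /andP[m0 m1].
have em0 : 0 < eps * m by rewrite mulr_gt0.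
have expL : sequences.expR (- ln (1 / (eps * m))) = eps * m.
  by rewrite -lnV ?posrE ?divr_gt0 // div1r invrK lnK.
have L0 : 0 <= ln (1 / (eps * m)).
  by rewrite ln_ge0 // ler_pdivlMr // mul1r mulr_ile1 // ltW.
move: (ln _) expL L0 => L expL L0.
have C0 : 0 < C by lra.
have CVh : C^-1 <= 2^-1 by rewrite lef_pV2 ?posrE.
have ch : 2^-1 <= 1 - C^-1 by lra.
have c0 : 0 <= 1 - C^-1 by lra.
have : 0 <= 2 * C * L by rewrite mulr_ge0 // mulr_ge0 // ltW.
move=> /truncn_itv/andP[]; move: (Num.truncn _) => k le_k lt_k.
exists k => //.
have le_exp : (1 - C^-1) ^+ k.+1 <= (eps * m) ^+ 2.
  apply: (@le_trans _ _ (sequences.expR (- C^-1) ^+ k.+1)).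
    by rewrite lerXn2r ?nnegrE ?expR_ge0 // expR_ge1Dx.
  rewrite -expRM_natl -expL -[leRHS]expRM_natl ler_expR mulrN mulrN lerN2.
  by rewrite ler_pdivlMr // mulrAC ltW.
have le_m2 : (eps * m) ^+ 2 <= eps ^+ 2 * m.
  by rewrite exprMn ler_wpM2l ?sqr_ge0 // expr2 ler_piMr // ltW.
have /ltW em : 0 < eps ^+ 2 * m by rewrite mulr_gt0 // exprn_gt0.
rewrite ler_pdivrMr // exprMn -mulrA.
have := le_trans (le_trans (ler_wpM2r (exprn_ge0 k c0) ch) _) le_m2.
rewrite -exprS => /(_ le_exp).
move: (eps ^+ 2 * m) (_ ^+ k) em {le_exp le_m2 lt_k le_k} => e d em le_d.
by clear -em le_d; lra.
Qed.

(** * Site updates as orthogonal projections *)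

Section SiteUpdateTheory.
Context {R : realType} {n : nat} {X : 'I_n -> finType}.
Local Notation state := {dffun forall i : 'I_n, X i}.
Context (pi : state -> R) (pi_ge0 : forall x, 0 <= pi x).
Local Notation w := (stationary pi).
Local Notation V := (site_update pi).

Lemma agree_offxx (i : 'I_n) (x : state) : agree_off i x x.
Proof. by apply/forallP => j; rewrite eqxx implybT. Qed.

Lemma agree_offC (i : 'I_n) (x y : state) : agree_off i x y = agree_off i y x.
Proof. by apply: eq_forallb => j; rewrite [x j == _]eq_sym. Qed.

Lemma agree_offL (i : 'I_n) (x y : state) : agree_off i x y ->
  agree_off i x =1 agree_off i y.
Proof.
move=> /forallP xy z; apply: eq_forallb => j.
by have := xy j; case: (j != i) => //= /eqP ->.
Qed.

Lemma stationary_gt0 x : 0 < w 0 x.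
Proof.
rewrite mxE lt_neqAle pi_ge0 eq_sym andbT.
by have := enum_valP x; rewrite inE.
Qed.

Lemma stationary_sum : \sum_x w 0 x = \sum_x pi x.
Proof.
under eq_bigr do rewrite mxE.
rewrite -(big_enum_val pi) big_mkcond; apply: eq_bigr => x _.
by rewrite inE; case: eqP.
Qed.

Definition fiber_weight (i : 'I_n) (x : 'I_#|supp pi|) : R :=
  \sum_(z | agree_off i (enum_val x) z) pi z.

Lemma fiber_weight_gt0 i x : 0 < fiber_weight i x.
Proof.
rewrite /fiber_weight (bigD1 (enum_val x)) ?agree_offxx //=.
rewrite ltr_pwDl ?sumr_ge0 //.
by have := stationary_gt0 x; rewrite mxE.
Qed.

Lemma fiber_weight_sum i x :
  fiber_weight i x = \sum_y (agree_off i (enum_val x) (enum_val y))%:R * w 0 y.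
Proof.
under eq_bigr do rewrite mxE.
rewrite -(big_enum_val (fun z => (agree_off i (enum_val x) z)%:R * pi z)).
rewrite /fiber_weight big_mkcond [RHS]big_mkcond /=; apply: eq_bigr => z _.
by rewrite inE; case: agree_off; case: eqP => [->|] //=; rewrite ?mul1r ?mul0r.
Qed.

Lemma fiber_weight_agree i x y : agree_off i (enum_val x) (enum_val y) ->
  fiber_weight i x = fiber_weight i y.
Proof. by move=> xy; apply: eq_bigl; exact: agree_offL. Qed.

Lemma site_updateE i x y :
  V i x y =
    (agree_off i (enum_val x) (enum_val y))%:R * w 0 y / fiber_weight i x.
Proof. by rewrite !mxE; case: ifP; rewrite ?mul1r ?mul0r. Qed.

Lemma site_update_stochastic i : stochastic (V i).
Proof.
split=> [x y|x].
  rewrite site_updateE !mulr_ge0 ?ler0n ?invr_ge0 // ltW //.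
    exact: stationary_gt0.
  exact: fiber_weight_gt0.
under eq_bigr do rewrite site_updateE.
by rewrite -mulr_suml -fiber_weight_sum divff // gt_eqF ?fiber_weight_gt0.
Qed.

Lemma site_update_reversible i : reversible w (V i).
Proof.
move=> x y; rewrite !site_updateE [agree_off i (enum_val y) _]agree_offC.
case xy: agree_off; last by rewrite !(mul0r, mulr0).
by rewrite (fiber_weight_agree xy); ring.
Qed.

(** Conditioning twice on the same coordinates is conditioning once: the kernel
    is constant along the fibers it averages over. *)
Lemma site_update_idem i : V i *m V i = V i.
Proof.
apply/matrixP => x z; rewrite mxE.
have [_ V1] := site_update_stochastic i.
transitivity (\sum_y V i x y * V i x z); last by rewrite -mulr_suml V1 mul1r.
apply: eq_bigr => y _; rewrite !site_updateE.
case xy: (agree_off i (enum_val x) (enum_val y)); last by rewrite !mul0r.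
by rewrite (agree_offL xy) (fiber_weight_agree xy).
Qed.

Lemma pi_min_gt0 : 0 < pi_min pi.
Proof.
apply: lt_bigmin => // x; rewrite inE lt_neqAle pi_ge0 eq_sym.
by move=> ->.
Qed.

Lemma pi_min_le1 : pi_min pi <= 1.
Proof. exact: bigmin_le_id. Qed.

Lemma pi_min_le x : pi_min pi <= w 0 x.
Proof. by rewrite mxE; apply: bigmin_le_cond; exact: enum_valP. Qed.

End SiteUpdateTheory.

(** * Comparison of the two dynamics *)

Theorem theorem1p2 (R : realType) :
  exists p : {poly {poly R}},
  forall (n : nat) (X : 'I_n -> finType)
         (pi : {dffun forall i : 'I_n, X i} -> R) (eps : R) (s : 'S_n) (t : nat),
    (1 <= n)%N ->
    (forall x, 0 <= pi x) ->
    \sum_x pi x = 1 ->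
    0 < eps <= 1 ->
    mixing_time (systematic_scan pi s) (stationary pi) (1 / 10%:R) = t%:R%:E ->
    (mixing_time (glauber pi) (stationary pi) eps
       <= (p.[(n%:R)%:P].[t%:R] * ln (1 / (eps * pi_min pi)))%:E)%E.
Proof.
exists ((10%:R *: ('X + 1) ^+ 2)%:P * 'X ^+ 2).
move=> n X pi eps s t n_gt0 pi0 pi1 eps01 /mixing_time_attained mixS.
set C : R := 5%:R * n%:R ^+ 2 * (t%:R + 1) ^+ 2.
have -> : ((10%:R *: ('X + 1) ^+ 2)%:P * 'X ^+ 2).[(n%:R)%:P].[t%:R] =
    2 * C :> R.
  rewrite hornerM hornerC horner_exp hornerX.
  rewrite hornerM hornerZ !horner_exp hornerD hornerX !hornerC.
  by rewrite /C; ring.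
have n1 : 1 <= n%:R :> R by rewrite ler1n.
have t0 : 0 <= t%:R :> R by rewrite ler0n.
have C2 : 2 <= C.
  have n2 : 1 <= n%:R ^+ 2 :> R by rewrite exprn_ege1.
  have t2 : 1 <= (t%:R + 1) ^+ 2 :> R by rewrite exprn_ege1 //; lra.
  by rewrite /C; nra.
have m01 : 0 < pi_min pi <= 1 by rewrite pi_min_gt0 ?pi_min_le1.
have [k le_k decay] := decay_bound C2 eps01 m01.
apply: (@le_trans _ _ k%:R%:E); last by rewrite lee_fin.
apply: mixing_time_le.
have /andP[eps0 _] := eps01.
apply: bigmax_le => [|x _]; first exact: ltW.
have wgt0 := stationary_gt0 pi0.
have wge0 y : 0 <= stationary pi 0 y by exact: ltW.
have w1 : \sum_y stationary pi 0 y = 1 by rewrite stationary_sum.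
have sV := site_update_stochastic pi0.
have rV : forall i, reversible _ (site_update pi i) :=
  @site_update_reversible _ _ _ pi.
have sG := stochastic_average n_gt0 erefl sV : stochastic (glauber pi).
have rG := reversible_average erefl rV : reversible _ (glauber pi).
have contr g : mean (stationary pi) g = 0 ->
    dot (stationary pi) (glauber pi *m g) (glauber pi *m g) <=
    (1 - C^-1) * dot (stationary pi) g g.
  apply: (average_contraction wge0 w1
    (h := fun i => s (rev_ord i)) n_gt0 erefl).
  - by [].
  - by [].
  - exact: site_update_idem.
  - by move=> i j /perm_inj/rev_ord_inj.
  - by move=> y; apply: le_trans (dTV_le_max _ _ _ _) mixS.
have c0 : 0 <= 1 - C^-1 by rewrite subr_ge0 invf_le1; lra.
have le_inv : (stationary pi 0 x)^-1 <= (pi_min pi)^-1.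
  by rewrite lef_pV2 ?posrE ?pi_min_gt0 // pi_min_le.
have le_sqr := dTV_exp_le wge0 w1 wgt0 k x c0 sG rG contr.
have : (2 * dTV (row x (glauber pi ^+ k)) (stationary pi)) ^+ 2 <=
    (2 * eps) ^+ 2.
  apply: le_trans le_sqr (le_trans (ler_wpM2l _ le_inv) decay).
  by rewrite exprn_ge0.
rewrite ler_sqr ?nnegrE; last by lra.
  by lra.
by rewrite !mulr_ge0 ?invr_ge0 // sumr_ge0.
Qed.
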